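(* Let $ABC$ be a (non-degenerate) triangle in the Euclidean plane with centroid $G$. For an exparabola $p$ of $ABC$, the following two statements are equivalent: (i) $p$ is a max-exparabola of $ABC$; (ii) the axis of $p$ contains the centroid $G$. In particular, the axes of the three max-exparabolas of $ABC$ intersect in $G$.
   Context: An exparabola of a triangle $ABC$ is a (real, non-degenerate) parabola that is tangent to the three side lines $BC$, $CA$, $AB$ of the triangle. The axis of a parabola is its line of symmetry. The exparabolas of $ABC$ form a one-parameter family indexed by $t\in\mathbb{R}\setminus\{0,1\}$: the exparabola $p(t)$ is the one whose points of tangency with $BC$, $CA$, $AB$ have homogeneous barycentric coordinates (weights of $A,B,C$ in this order) $(0,1,t-1)$, $(1,0,-t)$, $(1-t,t,0)$, respectively. The parameter $\varrho$ of a parabola is the distance between its focus and its directrix (equivalently, the radius of curvature at its vertex). A max-exparabola of $ABC$ is an exparabola of $ABC$ whose parameter is locally maximal in the family of exparabolas, i.e., $p(t^* )$ such that $t\mapsto\varrho(p(t))$ has a local maximum at $t^*$ on $\mathbb{R}\setminus\{0,1\}$. An exparabola is called opposite to $C$ if it is tangent to $AB$ in a point strictly between $A$ and $B$ (analogously for $A$ with side $BC$ and $B$ with side $CA$). Every triangle has exactly three max-exparabolas, one opposite to each vertex. *)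

(* Defs.v *)
(* Stdlib reals with Coquelicot *)
From Stdlib Require Import Reals.
From Coquelicot Require Import Coquelicot.
Open Scope R_scope.

(** The Euclidean plane is [R * R].  A line is always given by two points
    [X], [Y] of it; wherever such a pair occurs below the two points are
    distinct, either by an explicit hypothesis or because some point is
    required not to be collinear with them. *)
Definition point : Type := (R * R)%type.

Definition vec (X Y : point) : point := (fst Y - fst X, snd Y - snd X).
Definition translate (X : point) (k : R) (v : point) : point :=
  (fst X + k * fst v, snd X + k * snd v).
Definition dot (u v : point) : R := fst u * fst v + snd u * snd v.
Definition det (u v : point) : R := fst u * snd v - snd u * fst v.

Definition dist (X Y : point) : R := sqrt (dot (vec X Y) (vec X Y)).

Definition collinear (X Y Z : point) : Prop := det (vec X Y) (vec X Z) = 0.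

(** The distance of [Z] from the line [XY]. *)
Definition dist_line (X Y Z : point) : R :=
  Rabs (det (vec X Y) (vec X Z)) / dist X Y.

(** Image of [Z] under the reflection in the line [XY]. *)
Definition reflect (X Y Z : point) : point :=
  let v := vec X Y in
  let foot := translate X (dot (vec X Z) v / dot v v) v in
  translate Z 2 (vec Z foot).

Definition strictly_between (X Y Z : point) : Prop :=
  exists k : R, 0 < k < 1 /\ Z = translate X k (vec X Y).

(** The point with homogeneous barycentric coordinates [wa : wb : wc]
    (meaningful when [wa + wb + wc <> 0]). *)
Definition bary (A B C : point) (wa wb wc : R) : point :=
  ((wa * fst A + wb * fst B + wc * fst C) / (wa + wb + wc),
   (wa * snd A + wb * snd B + wc * snd C) / (wa + wb + wc)).

Definition centroid (A B C : point) : point := bary A B C 1 1 1.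

(** A parabola is given by its focus and a directrix (through two points) not
    containing the focus.  Different records may describe the same curve, so
    parabolas are compared with [same_parabola]. *)
Record parabola : Type := Parabola {
  focus : point;
  dir1 : point;
  dir2 : point;
  focus_not_on_directrix : ~ collinear dir1 dir2 focus
}.

Definition on_parabola (P : parabola) (X : point) : Prop :=
  dist X (focus P) = dist_line (dir1 P) (dir2 P) X.

Definition same_parabola (P Q : parabola) : Prop :=
  forall X : point, on_parabola P X <-> on_parabola Q X.

Definition parameter (P : parabola) : R :=
  dist_line (dir1 P) (dir2 P) (focus P).

Definition symmetry_line (P : parabola) (U V : point) : Prop :=
  U <> V /\ forall X : point, on_parabola P X <-> on_parabola P (reflect U V X).

(** A parabola has exactly one line of symmetry, its axis. *)
Definition on_axis (P : parabola) (X : point) : Prop :=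
  exists U V : point, symmetry_line P U V /\ collinear U V X.

Definition parabola_eqn (P : parabola) (X : point) : R :=
  dist X (focus P) ^ 2 - dist_line (dir1 P) (dir2 P) X ^ 2.

(** The parabola [P] is tangent at [T] to the line [XY].  The parabola is the
    zero set of the smooth function [parabola_eqn P], whose gradient does not
    vanish on it because the focus is not on the directrix; so tangency means
    that the derivative of this function at [T] along the line is zero. *)
Definition tangent_at (P : parabola) (X Y T : point) : Prop :=
  on_parabola P T /\ collinear X Y T /\
  is_derive (fun k : R => parabola_eqn P (translate T k (vec X Y))) 0 0.

Definition tangent_to (P : parabola) (X Y : point) : Prop :=
  exists T : point, tangent_at P X Y T.

Definition exparabola (A B C : point) (P : parabola) : Prop :=
  tangent_to P B C /\ tangent_to P C A /\ tangent_to P A B.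

Definition admissible (t : R) : Prop := t <> 0 /\ t <> 1.

(** [P] is the exparabola with index [t]. *)
Definition exparabola_at (A B C : point) (t : R) (P : parabola) : Prop :=
  tangent_at P B C (bary A B C 0 1 (t - 1)) /\
  tangent_at P C A (bary A B C 1 0 (- t)) /\
  tangent_at P A B (bary A B C (1 - t) t 0).

(** [p] enumerates the exparabolas; its values at [0] and [1] are
    irrelevant. *)
Definition exparabola_family (A B C : point) (p : R -> parabola) : Prop :=
  forall t : R, admissible t -> exparabola_at A B C t (p t).

Definition local_max_on (D : R -> Prop) (f : R -> R) (t : R) : Prop :=
  D t /\ within D (locally t) (fun s : R => f s <= f t).

Definition max_exparabola (A B C : point) (P : parabola) : Prop :=
  exparabola A B C P /\
  exists (p : R -> parabola) (t : R),
    exparabola_family A B C p /\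
    local_max_on admissible (fun s : R => parameter (p s)) t /\
    same_parabola P (p t).

(** The exparabola [P] is opposite to the vertex other than [X] and [Y]. *)
Definition touches_inside (P : parabola) (X Y : point) : Prop :=
  exists T : point, strictly_between X Y T /\ tangent_at P X Y T.

(* Main.v *)
Require Import Defs.
From Stdlib Require Import Reals Lra Psatz ClassicalEpsilon.
From Coquelicot Require Import Coquelicot.
Open Scope R_scope.

(** Put [C] at the origin and let [a], [b] be the position vectors of [A], [B],
    [D = det a b], [d = t a + (1 - t) b].  The exparabola with index [t] has
    axis direction [d], focus [a b / d] (as complex numbers) and squared
    parameter [4 D^4 (t (1 - t))^2 / |d|^6].  The derivative of the latter has
    the sign of [t (1 - t) crit t] for a cubic [crit], and [crit t] is
    proportional to the determinant of [d] and the vector from the focus to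
    the centroid; so the critical points are exactly the exparabolas whose
    axis contains the centroid.  By Cauchy-Schwarz every critical point is a
    strict local maximum, and [crit] has one root in each of the intervals
    [t < 0], [0 < t < 1], [t > 1]. *)

(** * Parabolas described by focus and focal vector; tangent lines *)

Lemma dot_pos (u : point) : u <> (0, 0) -> 0 < dot u u.
Proof.
  destruct u as [x y]; unfold dot; simpl; intros Hu.
  destruct (Req_dec x 0) as [-> | Hx]; [destruct (Req_dec y 0) as [-> | Hy] |].
  - now contradiction Hu.
  - nra.
  - nra.
Qed.

(** [u] is the vector from the foot of the focus [F] on the directrix to [F]. *)
Definition focal_eqn (u F X : point) : R :=
  (det u (vec F X))^2 / dot u u - 2 * dot u (vec F X) - dot u u.

(** The two directrix points stored in a record are arbitrary. The vector [u] removes this choice: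
    it has the direction of the axis, its length is the parameter, and together with the focus it
    fixes the equation. *)
Definition focal_vector (P : parabola) (u : point) : Prop :=
  u <> (0, 0) /\
  (forall X, parabola_eqn P X = focal_eqn u (focus P) X) /\
  parameter P = sqrt (dot u u).

Lemma dist_sqr (X Y : point) : Defs.dist X Y ^ 2 = dot (vec X Y) (vec X Y).
Proof.
  unfold Defs.dist; rewrite pow2_sqrt; [reflexivity |].
  unfold dot; nra.
Qed.

Lemma dist_line_sqr (X Y Z : point) :
  dist_line X Y Z ^ 2 = det (vec X Y) (vec X Z) ^ 2 / dot (vec X Y) (vec X Y).
Proof.
  rewrite <- dist_sqr; unfold dist_line, Rdiv.
  now rewrite Rpow_mult_distr, pow_inv, pow2_abs.
Qed.

Lemma dist_line_nonneg (X Y Z : point) : 0 <= dist_line X Y Z.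
Proof.
  unfold dist_line, Rdiv; apply Rmult_le_pos; [apply Rabs_pos |].
  unfold Defs.dist; destruct (Rle_lt_or_eq_dec _ _ (sqrt_pos (dot (vec X Y) (vec X Y)))) as [H | <-].
  - left; now apply Rinv_0_lt_compat.
  - rewrite Rinv_0; lra.
Qed.

Lemma on_parabola_eqn (P : parabola) (X : point) :
  on_parabola P X <-> parabola_eqn P X = 0.
Proof.
  unfold on_parabola, parabola_eqn.
  assert (H1 := dist_line_nonneg (dir1 P) (dir2 P) X).
  assert (H2 : 0 <= Defs.dist X (focus P)) by apply sqrt_pos.
  split; intros H; [rewrite H; ring | nra].
Qed.

Lemma focal_vector_exists (P : parabola) : exists u, focal_vector P u.
Proof.
  destruct P as [[f1 f2] [x1 x2] [y1 y2] H].
  unfold collinear, det, vec in H; simpl in H.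
  set (v1 := y1 - x1) in *; set (v2 := y2 - x2) in *.
  set (w := v1 * (f2 - x2) - v2 * (f1 - x1)) in *.
  assert (HV : 0 < v1 * v1 + v2 * v2).
  { destruct (Req_dec v1 0) as [E1 | ]; [| nra].
    destruct (Req_dec v2 0) as [E2 | ]; [| nra].
    exfalso; apply H; unfold w; rewrite E1, E2; ring. }
  set (k := w / (v1 * v1 + v2 * v2)).
  assert (Hk : k <> 0).
  { unfold k, Rdiv; apply Rmult_integral_contrapositive_currified; [exact H |].
    apply Rinv_neq_0_compat; lra. }
  assert (Hw : w = k * (v1 * v1 + v2 * v2)) by (unfold k; field; lra).
  (* The directrix direction turned by a right angle. Since [w] is the scalar product of
     [(- v2, v1)] with the vector from [dir1] to the focus, the factor [k] makes this the normal
     component of that vector. *)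
  exists (- k * v2, k * v1); split; [| split].
  - intros E; injection E as E1 E2.
    assert (v1 = 0) by nra; assert (v2 = 0) by nra; nra.
  - intros [z1 z2]; unfold parabola_eqn; rewrite dist_line_sqr, dist_sqr.
    unfold focal_eqn, dot, det, vec; simpl; fold v1 v2.
    assert (E : v1 * (z2 - x2) - v2 * (z1 - x1) = w + v1 * (z2 - f2) - v2 * (z1 - f1))
      by (unfold w; ring).
    rewrite E, Hw; field.
    split; [| lra].
    assert (0 < k * k) by nra; nra.
  - unfold parameter; simpl.
    rewrite <- (sqrt_pow2 (dist_line _ _ _)) by apply dist_line_nonneg.
    f_equal; rewrite dist_line_sqr; unfold dot, det, vec; simpl; fold v1 v2 w.
    rewrite Hw; field; lra.
Qed.

(** The last equation is the vanishing of the derivative of [focal_eqn] along the line, cleared of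
    the denominator [dot u u]; it is affine in [T]. *)
Lemma tangent_at_focal (P : parabola) (u X Y T : point) :
  focal_vector P u ->
  tangent_at P X Y T <->
  focal_eqn u (focus P) T = 0 /\ collinear X Y T /\
  det u (vec X Y) * det u (vec (focus P) T) = dot u u * dot u (vec X Y).
Proof.
  intros (Hu & HE & _).
  assert (HM := dot_pos u Hu).
  assert (D : is_derive (fun k => parabola_eqn P (translate T k (vec X Y))) 0
    (2 * det u (vec X Y) * det u (vec (focus P) T) / dot u u - 2 * dot u (vec X Y))).
  { apply is_derive_ext with (fun k => focal_eqn u (focus P) (translate T k (vec X Y))).
    { intros k; now rewrite HE. }
    unfold focal_eqn; set (M := dot u u) in *.
    unfold det, dot, vec, translate; simpl.
    auto_derive; [trivial | field; lra]. }
  unfold tangent_at; rewrite on_parabola_eqn, HE.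
  split; intros (H1 & H2 & H3); (split; [exact H1 | split; [exact H2 |]]).
  - apply is_derive_unique in D; apply is_derive_unique in H3.
    assert (E := eq_trans (eq_sym D) H3).
    apply (Rmult_eq_reg_r (2 / dot u u)).
    + apply Rminus_diag_uniq; rewrite <- E; field; lra.
    + apply Rgt_not_eq, Rdiv_lt_0_compat; lra.
  - replace 0 with (2 * det u (vec X Y) * det u (vec (focus P) T) / dot u u
      - 2 * dot u (vec X Y)) at 2; [exact D |].
    replace (2 * det u (vec X Y) * det u (vec (focus P) T))
      with (2 * (det u (vec X Y) * det u (vec (focus P) T))) by ring.
    rewrite H3; field; lra.
Qed.

(* The dual equation of the parabola: a line is tangent iff the foot of the
   perpendicular from the focus lies on the tangent at the vertex. *)
Lemma tangent_to_focal (P : parabola) (u X Y : point) :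
  focal_vector P u -> X <> Y -> tangent_to P X Y ->
  2 * det (vec X Y) (vec X (focus P)) * det (vec X Y) u
    = dot u u * dot (vec X Y) (vec X Y) /\ det (vec X Y) u <> 0.
Proof.
  intros Hf HXY [T HT].
  apply (tangent_at_focal P u X Y T Hf) in HT.
  destruct HT as (H1 & H2 & H3), Hf as (Hu & _ & _).
  assert (HM := dot_pos u Hu).
  assert (Hv : vec X Y <> (0, 0)).
  { intros E; apply HXY; destruct X, Y; injection E as E1 E2; simpl in *; f_equal; lra. }
  apply dot_pos in Hv.
  unfold collinear in H2.
  set (M := dot u u) in *.
  set (v := vec X Y) in *.
  set (tau := vec (focus P) T) in *.
  assert (E1 : det v (vec X (focus P)) = - det v tau).
  { unfold det, vec in *; subst tau; simpl in *; unfold vec; simpl; lra. }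
  assert (E2 : M * det v tau = dot u v * det u tau - det u v * dot u tau)
    by (unfold M, dot, det; ring).
  assert (E3 : M * dot v v = det u v ^ 2 + dot u v ^ 2)
    by (unfold M, dot, det; ring).
  assert (E4 : det v u = - det u v) by (unfold det; ring).
  assert (E5 : det u tau ^ 2 = M * (2 * dot u tau + M)).
  { unfold focal_eqn in H1; fold tau M in H1.
    replace (det u tau ^ 2) with ((det u tau ^ 2 / M - 2 * dot u tau - M) * M
      + M * (2 * dot u tau + M)) by (field; lra).
    rewrite H1; ring. }
  rewrite E1, E4.
  clearbody M v tau.
  set (al := det u v) in *; set (be := dot u v) in *.
  set (x := det u tau) in *; set (y := dot u tau) in *; set (z := det v tau) in *.
  split.
  (* After multiplication by [M * M], [E2] expresses [z] through [x] and [y]; then [H3] removes [x]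
     and the curve equation [E5] removes [y], so the contact point disappears. *)
  - apply (Rmult_eq_reg_l (M * M)); [| nra].
    transitivity (2 * M * al * (M * z)); [ring |].
    rewrite E2.
    transitivity (M * M * (M * dot v v)); [| ring].
    rewrite E3.
    transitivity (2 * M * be * (al * x) - M * al ^ 2 * (2 * y)); [ring |].
    rewrite H3.
    assert (E6 : M * al ^ 2 * (2 * y) = (al * x) ^ 2 - al ^ 2 * M * M).
    { rewrite Rpow_mult_distr, E5; ring. }
    rewrite E6, H3; ring.
  (* If the line were parallel to [u], [H3] would make it orthogonal to [u] as well. *)
  - intros E; assert (E0 : al = 0) by lra; rewrite E0 in *.
    assert (be = 0) by nra.
    nra.
Qed.

(** * Axis direction and focus as functions of the index *)

Definition scale (k : R) (u : point) : point := (k * fst u, k * snd u).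

(** With [a] and [b] drawn from [C], this leads to the point of [AB] that is the mirror image, in
    the midpoint of the side, of the contact point with barycentric coordinates [(1 - t, t, 0)]. *)
Definition axis_dir (a b : point) (t : R) : point :=
  (t * fst a + (1 - t) * fst b, t * snd a + (1 - t) * snd b).

Definition axis_vec (a b : point) (t : R) : point :=
  let d := axis_dir a b t in
  scale (2 * t * (1 - t) * det a b ^ 2 / dot d d ^ 2) d.

(* The quotient [a b / d] of complex numbers. *)
Definition focus_offset (a b : point) (t : R) : point :=
  let d := axis_dir a b t in
  let ab := (fst a * fst b - snd a * snd b, fst a * snd b + snd a * fst b) in
  (dot ab d / dot d d, det d ab / dot d d).

(** [axis_dir a b t] runs over the line through [a] and [b], which misses the origin. *)
Lemma axis_dir_pos (a b : point) (t : R) :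
  det a b <> 0 -> 0 < dot (axis_dir a b t) (axis_dir a b t).
Proof.
  intros H; apply dot_pos; intros E; injection E as E1 E2; apply H.
  unfold det.
  assert (F1 : det a (axis_dir a b t) = (1 - t) * det a b) by (unfold det; simpl; ring).
  assert (F2 : det (axis_dir a b t) b = t * det a b) by (unfold det; simpl; ring).
  unfold det in F1, F2; simpl in F1, F2; rewrite E1, E2 in F1, F2; lra.
Qed.

Lemma axis_vec_nonzero (a b : point) (t : R) :
  det a b <> 0 -> admissible t -> axis_vec a b t <> (0, 0).
Proof.
  intros H [Ht0 Ht1] E.
  assert (HN := axis_dir_pos a b t H).
  set (N := dot (axis_dir a b t) (axis_dir a b t)) in *.
  assert (Hr : 2 * t * (1 - t) * det a b ^ 2 / N ^ 2 <> 0).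
  { apply Rmult_integral_contrapositive_currified.
    - repeat apply Rmult_integral_contrapositive_currified; lra.
    - apply Rinv_neq_0_compat, pow_nonzero; lra. }
  unfold axis_vec, scale in E; fold N in E; injection E as E1 E2.
  apply Rmult_integral in E1; apply Rmult_integral in E2.
  assert (D1 : fst (axis_dir a b t) = 0) by (simpl; tauto).
  assert (D2 : snd (axis_dir a b t) = 0) by (simpl; tauto).
  unfold N, dot in HN; rewrite D1, D2 in HN; lra.
Qed.

Lemma det_inj (a b x y : point) :
  det a b <> 0 -> det a x = det a y -> det b x = det b y -> x = y.
Proof.
  intros H H1 H2.
  destruct a as [a1 a2], b as [b1 b2], x as [x1 x2], y as [y1 y2].
  unfold det in *; simpl in *.
  f_equal; apply (Rmult_eq_reg_l (a1 * b2 - a2 * b1)); auto.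
  - transitivity (b1 * (a1 * x2 - a2 * x1) - a1 * (b1 * x2 - b2 * x1)); [ring |].
    rewrite H1, H2; ring.
  - transitivity (b2 * (a1 * x2 - a2 * x1) - a2 * (b1 * x2 - b2 * x1)); [ring |].
    rewrite H1, H2; ring.
Qed.

(** In complex terms [det x y] is the imaginary part of the conjugate of [x] times [y]. Hence
    [det a (a b / d)] is [|a|^2] times the imaginary part of [b / d], which is [det d b / |d|^2],
    and [det d b = t * det a b]. *)
Lemma det_focus_offset_l (a b : point) (t : R) :
  det a b <> 0 ->
  det a (focus_offset a b t) =
    dot a a * t * det a b / dot (axis_dir a b t) (axis_dir a b t).
Proof.
  intros H; assert (HN := axis_dir_pos a b t H).
  unfold focus_offset; set (N := dot (axis_dir a b t) (axis_dir a b t)) in *.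
  unfold det, dot; simpl; field; lra.
Qed.

Lemma det_focus_offset_r (a b : point) (t : R) :
  det a b <> 0 ->
  det b (focus_offset a b t) =
    - dot b b * (1 - t) * det a b / dot (axis_dir a b t) (axis_dir a b t).
Proof.
  intros H; assert (HN := axis_dir_pos a b t H).
  unfold focus_offset; set (N := dot (axis_dir a b t) (axis_dir a b t)) in *.
  unfold det, dot; simpl; field; lra.
Qed.

(** The last three equations are the dual equations of the side lines. The first two give [det a f]
    and [det b f]; inserted in the third, they leave a relation [K] for [u] alone. The direction of
    [u] defines [t], [K] then fixes its length, and [f] follows from its two determinants. *)
Lemma dual_equations_solve (a b u f : point) :
  det a b <> 0 -> u <> (0, 0) ->
  det a u <> 0 -> det b u <> 0 -> det a u - det b u <> 0 ->
  2 * det a f * det a u = dot u u * dot a a ->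
  2 * det b f * det b u = dot u u * dot b b ->
  2 * (det a f - det b f - det a b) * (det a u - det b u)
    = dot u u * (dot a a - 2 * dot a b + dot b b) ->
  exists t, admissible t /\ u = axis_vec a b t /\ f = focus_offset a b t.
Proof.
  intros HD Hu Ha Hb Hab Ea Eb Eab.
  assert (HM := dot_pos u Hu).
  set (D := det a b) in *; set (M := dot u u) in *.
  set (p := det a u) in *; set (q := det b u) in *.
  (* The squared length of [q a - p b = - D u]. *)
  assert (Lag : q ^ 2 * dot a a - 2 * p * q * dot a b + p ^ 2 * dot b b = D ^ 2 * M).
  { unfold p, q, D, M, det, dot; ring. }
  (* The left side is of degree 3 in [u] and the right side of degree 4, so this determines the
     length of [u] from its direction. *)
  assert (K : 2 * p * q * (p - q) = - D * M ^ 2).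
  { apply (Rmult_eq_reg_l D); [| exact HD].
    assert (Xa : det a f = M * dot a a / (2 * p)) by (rewrite <- Ea; field; auto).
    assert (Xb : det b f = M * dot b b / (2 * q)) by (rewrite <- Eb; field; auto).
    rewrite Xa, Xb in Eab.
    apply (f_equal (fun x => x * (p * q))) in Eab.
    assert (Z : 2 * (M * dot a a / (2 * p) - M * dot b b / (2 * q) - D) * (p - q) * (p * q)
      = M * (q * dot a a - p * dot b b) * (p - q) - 2 * D * p * q * (p - q)) by (field; auto).
    rewrite Z in Eab.
    transitivity (- M * (q ^ 2 * dot a a - 2 * p * q * dot a b + p ^ 2 * dot b b)); [lra |].
    rewrite Lag; ring. }
  (* The index for which [axis_dir a b t] is parallel to [u]. *)
  set (t := - q / (p - q)).
  assert (Ht1 : 1 - t = p / (p - q)) by (unfold t; field; auto).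
  assert (Hd : axis_dir a b t = scale (D / (p - q)) u).
  { unfold axis_dir, scale; rewrite Ht1; unfold t.
    f_equal; apply (Rmult_eq_reg_r (p - q)); auto; field_simplify; auto;
      unfold p, q, D, det; ring. }
  assert (HN : dot (axis_dir a b t) (axis_dir a b t) = (D / (p - q)) ^ 2 * M).
  { rewrite Hd; unfold M, dot, scale; simpl; ring. }
  exists t; split; [| split].
  - split; intros E.
    + apply Hb; apply (Rmult_eq_reg_r (- / (p - q))).
      * replace (q * - / (p - q)) with t by (unfold t; field; auto); lra.
      * apply Ropp_neq_0_compat, Rinv_neq_0_compat; auto.
    + apply Ha; rewrite E in Ht1; apply (Rmult_eq_reg_r (/ (p - q))).
      * replace (p * / (p - q)) with (1 - 1) by (rewrite Ht1; reflexivity); lra.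
      * apply Rinv_neq_0_compat; auto.
  - unfold axis_vec; rewrite HN, Hd; fold D.
    assert (E : 2 * t * (1 - t) * D ^ 2 / ((D / (p - q)) ^ 2 * M) ^ 2 * (D / (p - q)) = 1).
    { rewrite Ht1; unfold t.
      transitivity (- (2 * p * q * (p - q)) / (D * M ^ 2)); [field; repeat split; lra |].
      rewrite K; field; lra. }
    destruct u as [u1 u2]; unfold scale in *; simpl fst; simpl snd.
    rewrite <- !Rmult_assoc, E; f_equal; ring.
  - apply (det_inj a b); [exact HD | |].
    + rewrite det_focus_offset_l, HN by exact HD; fold D.
      apply (Rmult_eq_reg_r (2 * p)); [| lra].
      transitivity (M * dot a a); [lra |].
      transitivity (- (2 * p * q * (p - q)) / (D * M) * dot a a);
        [rewrite K | unfold t]; field; repeat split; lra.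
    + rewrite det_focus_offset_r, HN, Ht1 by exact HD; fold D.
      apply (Rmult_eq_reg_r (2 * q)); [| lra].
      transitivity (M * dot b b); [lra |].
      transitivity (- (2 * p * q * (p - q)) / (D * M) * dot b b);
        [rewrite K |]; field; repeat split; lra.
Qed.

(** * Correspondence between exparabolas and indices *)

Lemma vec_eq_shift (X F : point) (f : point) :
  vec X F = f -> F = (fst X + fst f, snd X + snd f).
Proof.
  intros <-; destruct X, F; unfold vec; simpl; f_equal; ring.
Qed.

Lemma sides_nondegenerate (A B C : point) :
  ~ collinear A B C -> det (vec C A) (vec C B) <> 0 /\ B <> C /\ C <> A /\ A <> B.
Proof.
  intros H; split; [| repeat split]; intros E; apply H.
  - revert E; unfold collinear, det, vec; simpl; lra.
  - subst; unfold collinear, det, vec; simpl; ring.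
  - subst; unfold collinear, det, vec; simpl; ring.
  - subst; unfold collinear, det, vec; simpl; ring.
Qed.

Definition exparabola_data (A B C : point) (t : R) (P : parabola) : Prop :=
  focal_vector P (axis_vec (vec C A) (vec C B) t) /\
  vec C (focus P) = focus_offset (vec C A) (vec C B) t.

Lemma exparabola_has_data (A B C : point) (P : parabola) :
  ~ collinear A B C -> exparabola A B C P ->
  exists t, admissible t /\ exparabola_data A B C t P.
Proof.
  intros H (TA & TB & TC).
  destruct (sides_nondegenerate A B C H) as (HD & NA & NB & NC).
  destruct (focal_vector_exists P) as [u Hu].
  destruct (tangent_to_focal P u B C Hu NA TA) as [EA ZA].
  destruct (tangent_to_focal P u C A Hu NB TB) as [EB ZB].
  destruct (tangent_to_focal P u A B Hu NC TC) as [EC ZC].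
  destruct (dual_equations_solve (vec C A) (vec C B) u (vec C (focus P))) as (t & Ht & -> & Ef).
  - exact HD.
  - apply Hu.
  - exact ZB.
  - intros E; apply ZA; rewrite <- Ropp_0, <- E; unfold det, vec; simpl; ring.
  - intros E; apply ZC; rewrite <- Ropp_0, <- E; unfold det, vec; simpl; ring.
  - exact EB.
  - etransitivity; [| etransitivity; [exact EA |]]; unfold det, dot, vec; simpl; ring.
  - etransitivity; [| etransitivity; [exact EC |]]; unfold det, dot, vec; simpl; ring.
  - now exists t.
Qed.

(** Converse of the dual equation for a proposed contact point. The quadratic curve equation at [T]
    follows from the dual equation and the affine derivative condition, by running the elimination
    of [tangent_to_focal] backwards. *)
Lemma tangent_at_of_dual (P : parabola) (u X Y T : point) :
  focal_vector P u -> collinear X Y T -> det (vec X Y) u <> 0 ->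
  2 * det (vec X Y) (vec X (focus P)) * det (vec X Y) u
    = dot u u * dot (vec X Y) (vec X Y) ->
  det u (vec X Y) * det u (vec (focus P) T) = dot u u * dot u (vec X Y) ->
  tangent_at P X Y T.
Proof.
  intros Hf HT Hn HD H3.
  apply (tangent_at_focal P u X Y T Hf); split; [| split; assumption].
  assert (HM := dot_pos u (proj1 Hf)).
  unfold collinear in HT.
  set (v := vec X Y) in *; set (tau := vec (focus P) T) in *.
  assert (E1 : det v (vec X (focus P)) = - det v tau).
  { unfold det, vec in *; subst tau; simpl in *; unfold vec; simpl; lra. }
  assert (E4 : det v u = - det u v) by (unfold det; ring).
  rewrite E1, E4 in HD; rewrite E4 in Hn; clear E1 E4.
  unfold focal_eqn; fold tau.
  set (M := dot u u) in *.
  assert (E2 : M * det v tau = dot u v * det u tau - det u v * dot u tau)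
    by (unfold M, dot, det; ring).
  assert (E3 : M * dot v v = det u v ^ 2 + dot u v ^ 2)
    by (unfold M, dot, det; ring).
  clearbody M v tau.
  set (al := det u v) in *; set (be := dot u v) in *.
  set (x := det u tau) in *; set (y := dot u tau) in *; set (z := det v tau) in *.
  assert (K : x ^ 2 = M * (2 * y + M)).
  { apply (Rmult_eq_reg_l (al ^ 2)); [| apply pow_nonzero; lra].
    assert (F1 : 2 * al * (M * z) = M * (M * dot v v)).
    { transitivity (M * (2 * - z * - al)); [ring | rewrite HD; ring]. }
    rewrite E2, E3 in F1.
    assert (F2 : 2 * be * (al * x) - 2 * al ^ 2 * y = M * (al ^ 2 + be ^ 2)) by lra.
    rewrite H3 in F2.
    transitivity ((al * x) ^ 2); [ring |]; rewrite H3.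
    transitivity (M * (M * be ^ 2)); [ring |].
    replace (M * be ^ 2) with (2 * al ^ 2 * y + M * al ^ 2) by lra; ring. }
  rewrite K; field; lra.
Qed.

Lemma data_tangent (A B C : point) (t : R) (P : parabola) :
  ~ collinear A B C -> admissible t -> exparabola_data A B C t P ->
  exparabola_at A B C t P.
Proof.
  intros H Ht [Hu Hf].
  destruct (sides_nondegenerate A B C H) as (HD & _).
  set (a := vec C A) in *; set (b := vec C B) in *.
  assert (HN := axis_dir_pos a b t HD).
  assert (E1 := det_focus_offset_l a b t HD).
  assert (E2 := det_focus_offset_r a b t HD).
  rewrite <- Hf in E1, E2.
  assert (Ed : axis_dir a b t = (t * fst a + (1 - t) * fst b, t * snd a + (1 - t) * snd b))
    by reflexivity.
  assert (Hr := axis_vec_nonzero a b t HD Ht).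
  unfold axis_vec in Hu, Hr.
  set (d := axis_dir a b t) in *; set (N := dot d d) in *.
  set (D := det a b) in *.
  set (f := vec C (focus P)) in *.
  (* From here on [d] and [f] enter only through these determinants and scalar products, which
     reduces every tangency condition to an identity in [t], [D] and the scalar products of [a] and
     [b]. *)
  assert (Da : det a d = (1 - t) * D) by (rewrite Ed; unfold D, det; cbn [fst snd]; ring).
  assert (Db : det b d = - t * D) by (rewrite Ed; unfold D, det; cbn [fst snd]; ring).
  assert (Df : det d f = t * det a f + (1 - t) * det b f)
    by (rewrite Ed; unfold det; cbn [fst snd]; ring).
  assert (da : dot d a = t * dot a a + (1 - t) * dot a b)
    by (rewrite Ed; unfold dot; cbn [fst snd]; ring).
  assert (db : dot d b = t * dot a b + (1 - t) * dot b b)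
    by (rewrite Ed; unfold dot; cbn [fst snd]; ring).
  assert (NE : N = t ^ 2 * dot a a + 2 * t * (1 - t) * dot a b + (1 - t) ^ 2 * dot b b)
    by (unfold N; rewrite Ed; unfold dot; cbn [fst snd]; ring).
  rewrite E1, E2 in Df; clear Ed Hf; clearbody d.
  set (r := 2 * t * (1 - t) * D ^ 2 / N ^ 2) in *.
  assert (Er : r * N = 2 * t * (1 - t) * D ^ 2 / N) by (unfold r; field; lra).
  assert (Hr0 : r <> 0).
  { intros E; apply Hr; rewrite E; unfold scale; f_equal; ring. }
  (* With [u = r d], the right side of each condition has one more factor [r] than the left;
     cancelling the common powers leaves a single [r]. *)
  assert (tangent : forall X Y T, collinear X Y T -> det (vec X Y) d <> 0 ->
    2 * det (vec X Y) (vec X (focus P)) * det (vec X Y) d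
      = r * N * dot (vec X Y) (vec X Y) ->
    det d (vec X Y) * det d (vec (focus P) T) = r * N * dot d (vec X Y) ->
    tangent_at P X Y T).
  { intros X Y T HT Hn HX HY; apply (tangent_at_of_dual P _ _ _ _ Hu HT).
    - replace (det _ (scale r d)) with (r * det (vec X Y) d)
        by (unfold det, scale; cbn [fst snd]; ring).
      now apply Rmult_integral_contrapositive_currified.
    - transitivity (r * (2 * det (vec X Y) (vec X (focus P)) * det (vec X Y) d)).
      + unfold det, scale; cbn [fst snd]; ring.
      + rewrite HX; unfold N, dot, scale; cbn [fst snd]; ring.
    - transitivity (r ^ 2 * (det d (vec X Y) * det d (vec (focus P) T))).
      + unfold det, scale; cbn [fst snd]; ring.
      + rewrite HY; unfold N, dot, scale; cbn [fst snd]; ring. }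
  rewrite Er in tangent.
  destruct Ht as [Ht0 Ht1].
  clearbody r N; clear Hr Er Hr0 Hu.
  split; [| split]; apply tangent.
  - unfold collinear, det, bary, vec; simpl; field; lra.
  - replace (det (vec B C) d) with (t * D); [now apply Rmult_integral_contrapositive_currified |].
    transitivity (- det b d); [rewrite Db; ring | unfold det, b, vec; simpl; ring].
  - transitivity (2 * det b f * det b d); [unfold det, b, f, vec; simpl; ring |].
    rewrite E2, Db.
    transitivity (2 * t * (1 - t) * D ^ 2 / N * dot b b); [field; lra |].
    f_equal; unfold dot, b, vec; simpl; ring.
  (* Seen from [C], the contact points on [BC], [CA], [AB] are [b / t], [a / (1 - t)] and
     [(1 - t) a + t b]. *)
  - transitivity (det b d * (- det b d / t - det d f)).
    { unfold det, b, f, vec, bary; simpl; field; lra. }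
    transitivity (- (2 * t * (1 - t) * D ^ 2 / N * dot d b)).
    2: { rewrite Ropp_mult_distr_r; f_equal; unfold dot, b, vec; simpl; ring. }
    rewrite Db, Df, db; clearbody D; rewrite NE; field; rewrite <- NE; lra.
  - unfold collinear, det, bary, vec; simpl; field; lra.
  - fold a; rewrite Da; apply Rmult_integral_contrapositive_currified; lra.
  - fold a f; rewrite E1, Da; field; lra.
  - fold a; transitivity (det a d * (- (- det a d / (1 - t) - det d f))).
    { unfold det, a, f, vec, bary; simpl; field; lra. }
    rewrite Da, Df, da; clearbody D; rewrite NE; field; rewrite <- NE; lra.
  - unfold collinear, det, bary, vec; simpl; field; lra.
  - replace (det (vec A B) d) with (- D); [lra |].
    transitivity (det b d - det a d); [rewrite Da, Db; ring | unfold det, a, b, vec; simpl; ring].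
  - transitivity (2 * (det b f - det a f + D) * (det b d - det a d)).
    { unfold D, det, a, b, f, vec; simpl; ring. }
    transitivity (2 * t * (1 - t) * D ^ 2 / N * (dot a a - 2 * dot a b + dot b b)).
    2: { f_equal; unfold dot, a, b, vec; simpl; ring. }
    rewrite E1, E2, Da, Db; clearbody D; rewrite NE; field; rewrite <- NE; lra.
  - transitivity ((det a d - det b d) * (- (1 - t) * det a d - t * det b d - det d f)).
    { unfold det, a, b, f, vec, bary; simpl; field; lra. }
    transitivity (2 * t * (1 - t) * D ^ 2 / N * (dot d b - dot d a)).
    2: { f_equal; unfold dot, a, b, vec; simpl; ring. }
    rewrite Da, Db, Df, da, db; clearbody D; rewrite NE; field; rewrite <- NE; lra.
Qed.

Lemma parabola_with_focal_vector (u F : point) :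
  u <> (0, 0) -> exists P, focus P = F /\ focal_vector P u.
Proof.
  intros Hu; assert (HM := dot_pos u Hu).
  destruct u as [u1 u2], F as [f1 f2].
  (* The directrix passes through [F - u], in the direction of [u] turned by a right angle. *)
  set (X := (f1 - u1, f2 - u2)); set (Y := (f1 - u1 - u2, f2 - u2 + u1)).
  unfold dot in HM; simpl in HM.
  assert (HF : ~ collinear X Y (f1, f2)).
  { unfold collinear, det, vec; simpl; intros E; lra. }
  exists (Parabola _ X Y HF); split; [reflexivity | split; [exact Hu | split]].
  - intros [z1 z2]; unfold parabola_eqn; rewrite dist_sqr, dist_line_sqr.
    unfold focal_eqn, det, dot, vec; simpl; field; repeat split; lra.
  - unfold parameter; rewrite <- (sqrt_pow2 (dist_line _ _ _)) by apply dist_line_nonneg.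
    f_equal; rewrite dist_line_sqr; unfold det, dot, vec; simpl; field; lra.
Qed.

Lemma data_exists (A B C : point) (t : R) :
  ~ collinear A B C -> admissible t -> exists P, exparabola_data A B C t P.
Proof.
  intros H Ht.
  destruct (sides_nondegenerate A B C H) as (HD & _).
  set (f := focus_offset (vec C A) (vec C B) t).
  destruct (parabola_with_focal_vector (axis_vec (vec C A) (vec C B) t)
    (fst C + fst f, snd C + snd f)) as (P & HF & HP).
  { now apply axis_vec_nonzero. }
  exists P; split; [exact HP |].
  rewrite HF; fold f; destruct f; unfold vec; simpl; f_equal; ring.
Qed.

Lemma same_data_same_eqn (A B C : point) (t : R) (P Q : parabola) :
  exparabola_data A B C t P -> exparabola_data A B C t Q ->
  forall X, parabola_eqn P X = parabola_eqn Q X.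
Proof.
  intros [HP FP] [HQ FQ] X.
  rewrite (proj1 (proj2 HP)), (proj1 (proj2 HQ)).
  now rewrite (vec_eq_shift _ _ _ FP), (vec_eq_shift _ _ _ FQ).
Qed.

(** Collinearity fixes the determinant of the contact point with the direction of the line, the
    derivative condition its determinant with [u]; these two vectors are independent. *)
Lemma tangent_point_unique (P : parabola) (X Y T T' : point) :
  X <> Y -> tangent_at P X Y T -> tangent_at P X Y T' -> T = T'.
Proof.
  intros HXY HT HT'.
  destruct (focal_vector_exists P) as [u Hu].
  assert (Hn : det (vec X Y) u <> 0).
  { apply (tangent_to_focal P u X Y Hu HXY); now exists T. }
  apply (tangent_at_focal P u X Y _ Hu) in HT, HT'.
  destruct HT as (_ & H1 & H2), HT' as (_ & H3 & H4).
  rewrite <- H4 in H2; apply Rmult_eq_reg_l in H2.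
  2: { intros E; apply Hn; rewrite <- Ropp_0, <- E; unfold det; ring. }
  apply (det_inj _ _ _ _ Hn).
  - unfold collinear in H1, H3; rewrite <- H3 in H1.
    unfold det, vec in *; simpl in *; lra.
  - unfold det, vec in *; simpl in *; lra.
Qed.

(** The dual equations yield the data for some index [s]. By uniqueness of the contact point on
    [AB], whose position determines the index, [s = t]. *)
Lemma exparabola_at_iff_data (A B C : point) (t : R) (P : parabola) :
  ~ collinear A B C -> admissible t ->
  exparabola_at A B C t P <-> exparabola_data A B C t P.
Proof.
  intros H Ht; split; [| now apply data_tangent].
  intros (HA & HB & HC).
  destruct (exparabola_has_data A B C P H) as (s & Hs & Hd).
  { repeat split; eexists; eassumption. }
  destruct (data_tangent A B C s P H Hs Hd) as (_ & _ & HC').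
  destruct (sides_nondegenerate A B C H) as (HD & _ & _ & NC).
  assert (E := tangent_point_unique P A B _ _ NC HC HC').
  replace t with s; [exact Hd |].
  assert (E1 := f_equal fst E); assert (E2 := f_equal snd E).
  unfold bary in E1, E2; simpl in E1, E2.
  replace (1 - t + t + 0) with 1 in E1, E2 by ring.
  replace (1 - s + s + 0) with 1 in E1, E2 by ring.
  rewrite !Rdiv_1_r in E1, E2.
  assert (Z1 : (s - t) * (fst B - fst A) = 0) by lra.
  assert (Z2 : (s - t) * (snd B - snd A) = 0) by lra.
  apply Rmult_integral in Z1; apply Rmult_integral in Z2.
  destruct Z1 as [Z1 | Z1], Z2 as [Z2 | Z2]; try lra.
  contradiction NC; destruct A, B; simpl in *; f_equal; lra.
Qed.

(** * The axis is the only line of symmetry *)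

(** Reflection in the axis keeps [dot u (vec F X)] and negates [det u (vec F X)], which enters
    [focal_eqn] squared. *)
Lemma reflect_axis (u F X : point) :
  u <> (0, 0) ->
  focal_eqn u F (reflect F (fst F + fst u, snd F + snd u) X) = focal_eqn u F X.
Proof.
  intros Hu; assert (HM := dot_pos u Hu).
  destruct u as [u1 u2], F as [f1 f2], X as [x1 x2].
  unfold focal_eqn, reflect, translate, det, dot, vec in *; simpl in *.
  field; repeat split; lra.
Qed.

(* [(s^2 - 1)/2] and [s] are coordinates in the frame of [u] and its rotation
   by a right angle. *)
Definition param_point (u F : point) (s : R) : point :=
  (fst F + (s ^ 2 - 1) / 2 * fst u - s * snd u,
   snd F + (s ^ 2 - 1) / 2 * snd u + s * fst u).

Lemma param_point_on (u F : point) (s : R) :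
  u <> (0, 0) -> focal_eqn u F (param_point u F s) = 0.
Proof.
  intros Hu; assert (HM := dot_pos u Hu).
  unfold focal_eqn, param_point, det, dot, vec in *; simpl in *; field; lra.
Qed.

Lemma vec_pos (X Y : point) : X <> Y -> 0 < dot (vec X Y) (vec X Y).
Proof.
  intros H; apply dot_pos; intros E; apply H.
  destruct X, Y; injection E as E1 E2; simpl in *; f_equal; lra.
Qed.

Lemma collinear_parallel (u F U V X : point) :
  u <> (0, 0) -> U <> V -> det u (vec U V) = 0 -> det u (vec F U) = 0 ->
  collinear U V X <-> det u (vec F X) = 0.
Proof.
  intros Hu HUV Hv HF.
  assert (HM := dot_pos u Hu).
  assert (E : dot u u * det (vec U V) (vec U X) = dot u (vec U V) * det u (vec F X)).
  { transitivity (dot u (vec U V) * (det u (vec F X) - det u (vec F U))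
      - det u (vec U V) * dot u (vec U X)).
    - unfold dot, det, vec; simpl; ring.
    - rewrite HF, Hv; ring. }
  assert (Hn : dot u (vec U V) <> 0).
  { intros E0.
    assert (E1 : dot u u * dot (vec U V) (vec U V) = 0).
    { transitivity (dot u (vec U V) ^ 2 + det u (vec U V) ^ 2);
        [unfold dot, det, vec; simpl; ring | rewrite E0, Hv; ring]. }
    assert (HV := vec_pos U V HUV); nra. }
  unfold collinear; split; intros E1; rewrite E1, Rmult_0_r in E.
  - symmetry in E; apply Rmult_integral in E; tauto.
  - apply Rmult_integral in E; destruct E; [lra | assumption].
Qed.

(** Reflecting the points [param_point u F s] gives a polynomial identity [T] in [s]. Its leading
    coefficient forces [UV] to be parallel or orthogonal to [u]; lower coefficients exclude the
    orthogonal case and put [U] on the line through the focus along [u]. *)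
Lemma symmetry_line_axis (P : parabola) (u U V X : point) :
  focal_vector P u -> symmetry_line P U V ->
  collinear U V X <-> det u (vec (focus P) X) = 0.
Proof.
  intros (Hu & HE & _) [HUV HS].
  assert (HM := dot_pos u Hu).
  set (F := focus P) in *.
  set (M := dot u u) in *.
  set (v := vec U V).
  assert (HV : 0 < dot v v) by now apply vec_pos.
  set (W := dot v v) in *.
  set (p := vec F U).
  assert (S : forall s,
    (det u (vec F (reflect U V (param_point u F s)))) ^ 2 =
    M * (2 * dot u (vec F (reflect U V (param_point u F s))) + M)).
  { intros s.
    assert (E : focal_eqn u F (reflect U V (param_point u F s)) = 0).
    { rewrite <- HE; apply on_parabola_eqn, (proj1 (HS _)), on_parabola_eqn.
      rewrite HE; now apply param_point_on. }
    unfold focal_eqn in E; fold M in E.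
    match goal with |- ?x ^ 2 = M * (2 * ?y + M) =>
      transitivity ((x ^ 2 / M - 2 * y - M) * M + M * (2 * y + M)); [field; lra | rewrite E; ring] end. }
  set (al := dot u v) in *; set (be := det u v) in *.
  set (x := dot u p) in *; set (y := det u p) in *.
  set (c := dot v p).
  assert (R1 : forall s, det u (vec F (reflect U V (param_point u F s))) =
    2 * ((s ^ 2 - 1) / 2 * al + s * be - c) * be / W - s * M + 2 * y).
  { intros s; unfold reflect; fold v W; subst M al be c y.
    unfold p, param_point, det, dot, vec, translate; simpl; field; lra. }
  assert (R2 : forall s, dot u (vec F (reflect U V (param_point u F s))) =
    2 * ((s ^ 2 - 1) / 2 * al + s * be - c) * al / W - (s ^ 2 - 1) / 2 * M + 2 * x).
  { intros s; unfold reflect; fold v W; subst M al be c x.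
    unfold p, param_point, det, dot, vec, translate; simpl; field; lra. }
  assert (L : al ^ 2 + be ^ 2 = M * W) by (unfold al, be, M, W, dot, det; ring).
  assert (T : forall s,
    (2 * ((s ^ 2 - 1) / 2 * al + s * be - c) * be / W - s * M + 2 * y) ^ 2 =
    M * (2 * (2 * ((s ^ 2 - 1) / 2 * al + s * be - c) * al / W
      - (s ^ 2 - 1) / 2 * M + 2 * x) + M)).
  { intros s; now rewrite <- R1, <- R2. }
  clear R1 R2 S.
  (* The fourth difference of [T] at [-2, ..., 2] isolates the coefficient of
     [s ^ 4]. *)
  assert (Z : (al * be / W) ^ 2 = 0).
  { assert (T0 := T 0); assert (T1 := T 1); assert (T2 := T 2).
    assert (T3 := T (-1)); assert (T4 := T (-2)).
    unfold Rdiv in *; lra. }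
  assert (Z' : al = 0 \/ be = 0).
  { apply Rmult_integral.
    apply (Rmult_eq_reg_r (/ W)); [| apply Rinv_neq_0_compat; lra].
    rewrite Rmult_0_l; change (al * be / W = 0); nra. }
  clear Z; destruct Z' as [Z | Z].
  - (* The reflection would reverse the direction of the axis. *)
    exfalso; rewrite Z in *.
    assert (E : be ^ 2 / W = M) by (replace (be ^ 2) with (M * W) by lra; field; lra).
    assert (T' : forall s, (s * M - 2 * c * be / W + 2 * y) ^ 2
      = M * (2 * (- (s ^ 2 - 1) / 2 * M + 2 * x) + M)).
    { intros s; rewrite <- E at 1.
      transitivity ((2 * ((s ^ 2 - 1) / 2 * 0 + s * be - c) * be / W - s * (be ^ 2 / W) + 2 * y) ^ 2);
        [field; lra | rewrite E, T; field; lra]. }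
    (* The second difference compares the coefficients of [s ^ 2], which are [M ^ 2] on the left and
       [- M ^ 2] on the right. *)
    assert (T0 := T' 0); assert (T1 := T' 1); assert (T2 := T' (-1)).
    unfold Rdiv in *; nra.
  - rewrite Z in *.
    (* For [be = 0] the right side of [T] is even in [s], so the odd part of the left side, a
       multiple of [M * y], vanishes. *)
    assert (T1 := T 1); assert (T2 := T (-1)).
    assert (E : M * y = 0) by (unfold Rdiv in *; lra).
    apply Rmult_integral in E; destruct E as [E | E]; [lra |].
    now apply collinear_parallel.
Qed.

(** * Calculus of the squared parameter as a function of the index *)

Definition quad (B k E t : R) : R := B + 2 * k * t + E * t ^ 2.
(** The squared parameter without its constant factor [4 D^4]; [quad] stands for [|d|^2]. *)
Definition gain (B k E t : R) : R := (t * (1 - t)) ^ 2 / quad B k E t ^ 3.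
Definition crit (B k E t : R) : R :=
  (1 - 2 * t) * quad B k E t - 3 * t * (1 - t) * (k + E * t).

Lemma quad_pos (B k E t : R) : 0 < E -> k ^ 2 < B * E -> 0 < quad B k E t.
Proof.
  intros HE H; apply (Rmult_lt_reg_l E); [exact HE |].
  rewrite Rmult_0_r; unfold quad.
  replace (E * (B + 2 * k * t + E * t ^ 2)) with ((k + E * t) ^ 2 + (B * E - k ^ 2)) by ring.
  assert (0 <= (k + E * t) ^ 2) by apply pow2_ge_0; lra.
Qed.

Lemma gain_derive (B k E t : R) :
  0 < E -> k ^ 2 < B * E ->
  is_derive (gain B k E) t (2 * t * (1 - t) * crit B k E t / quad B k E t ^ 4).
Proof.
  intros HE H; assert (HN := quad_pos B k E t HE H).
  unfold gain, crit, quad in *; auto_derive.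
  - repeat apply Rmult_integral_contrapositive_currified; lra.
  - field; lra.
Qed.

(** By the product rule, at a root of [crit] only the weight times the derivative [c'] of [crit]
    survives; of the weight only differentiability enters. *)
Lemma gain_derive2_at_root (B k E t : R) :
  0 < E -> k ^ 2 < B * E -> crit B k E t = 0 ->
  is_derive (fun s => 2 * s * (1 - s) * crit B k E s / quad B k E s ^ 4) t
    (2 * (t * (1 - t)
      * (- 2 * quad B k E t - (1 - 2 * t) * (k + E * t) - 3 * t * (1 - t) * E))
      / quad B k E t ^ 4).
Proof.
  intros HE H H0; assert (HN := quad_pos B k E t HE H).
  set (N := quad B k E t) in *.
  set (c' := - 2 * N - (1 - 2 * t) * (k + E * t) - 3 * t * (1 - t) * E).
  assert (Dc : is_derive (crit B k E) t c').
  { unfold c', N, crit, quad; auto_derive; [trivial | ring]. }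
  assert (Dw : exists w, is_derive (fun s => 2 * s * (1 - s) / quad B k E s ^ 4) t w).
  { eexists; apply Derive_correct; unfold quad; auto_derive.
    unfold N, quad in HN; repeat apply Rmult_integral_contrapositive_currified; lra. }
  destruct Dw as [w Dw].
  apply is_derive_ext with (fun s => 2 * s * (1 - s) / quad B k E s ^ 4 * crit B k E s).
  { intros s; set (x := crit B k E s); set (y := quad B k E s ^ 4).
    change (2 * s * (1 - s) / y * x = 2 * s * (1 - s) * x / y); unfold Rdiv; ring. }
  evar_last.
  - apply (is_derive_mult _ _ _ _ _ Dw Dc); intros; apply Rmult_comm.
  - unfold plus, mult; simpl; rewrite H0; fold N; field; lra.
Qed.

(** This gives the sign of the second derivative of [gain] at a critical point. With
    [q = t (1 - t)], [m = 1 - 2 t] and [x = k + E t], a root satisfies [3 q x = m N]. After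
    multiplication by [3 N], Cauchy-Schwarz and [m^2 = 1 - 4 q] bound the expression by
    [- (2 - 2 q) N^2], where [q <= 1/4]. *)
Lemma root_simple (B k E t : R) :
  0 < E -> k ^ 2 < B * E -> admissible t -> crit B k E t = 0 ->
  t * (1 - t) * (- 2 * quad B k E t - (1 - 2 * t) * (k + E * t) - 3 * t * (1 - t) * E) < 0.
Proof.
  intros HE H [Ht0 Ht1] H0; assert (HN := quad_pos B k E t HE H).
  (* Cauchy-Schwarz *)
  assert (CS : (k + E * t) ^ 2 < E * quad B k E t) by (unfold quad; nra).
  unfold crit in H0.
  set (N := quad B k E t) in *; set (x := k + E * t) in *.
  assert (Hq : t * (1 - t) <> 0) by (apply Rmult_integral_contrapositive_currified; lra).
  assert (Hm : (1 - 2 * t) ^ 2 = 1 - 4 * (t * (1 - t))) by ring.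
  assert (Hq4 := pow2_ge_0 (1 - 2 * t)).
  replace (3 * t * (1 - t) * E) with (3 * (t * (1 - t)) * E) by ring.
  replace (3 * t * (1 - t) * x) with (3 * (t * (1 - t)) * x) in H0 by ring.
  set (q := t * (1 - t)) in *; set (m := 1 - 2 * t) in *.
  clearbody N x q m.
  apply (Rmult_lt_reg_l (3 * N)); [lra |]; rewrite Rmult_0_r.
  assert (E1 : 3 * q * x = m * N) by lra.
  assert (E2 : 9 * q ^ 2 * x ^ 2 < 9 * q ^ 2 * (E * N)) by (apply Rmult_lt_compat_l; [nra | lra]).
  assert (E3 : 9 * q ^ 2 * x ^ 2 = m ^ 2 * N ^ 2).
  { transitivity ((3 * q * x) ^ 2); [ring | rewrite E1; ring]. }
  assert (E4 : 3 * N * (q * (- 2 * N - m * x - 3 * q * E)) =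
    - 6 * q * N ^ 2 - m * N * (3 * q * x) - 9 * q ^ 2 * (E * N)) by ring.
  rewrite E4, E1.
  assert (E5 : - 6 * q * N ^ 2 - 2 * (m ^ 2 * N ^ 2) = - (2 - 2 * q) * N ^ 2).
  { rewrite Hm; ring. }
  assert (0 < (2 - 2 * q) * N ^ 2) by (apply Rmult_lt_0_compat; [lra | nra]).
  lra.
Qed.

Lemma second_derivative_test (f f' : R -> R) (t l : R) :
  (forall s, is_derive f s (f' s)) -> is_derive f' t l -> f' t = 0 -> l < 0 ->
  locally t (fun s => f s <= f t).
Proof.
  intros Df Df' H0 Hl.
  apply is_derive_Reals in Df'.
  (* A difference quotient of [f'] that is closer than [- l] to [l] is negative, so [f'] changes
     sign from plus to minus at [t]; the mean value theorem concludes. *)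
  destruct (Df' (- l)) as [eps He]; [lra |].
  exists eps; intros s Hs.
  change (Rabs (s - t) < eps) in Hs.
  assert (sgn : forall c, c <> t -> Rabs (c - t) < eps -> f' c * (c - t) < 0).
  { intros c Hc Hce.
    assert (Hd := He (c - t) ltac:(lra) Hce).
    replace (t + (c - t)) with c in Hd by ring.
    rewrite H0, Rminus_0_r in Hd.
    apply Rabs_def2 in Hd.
    replace (f' c * (c - t)) with (f' c / (c - t) * (c - t) ^ 2) by (field; lra).
    assert (0 < (c - t) ^ 2) by (apply pow2_gt_0; lra).
    nra. }
  destruct (MVT_gen f t s f') as (c & Hc & E).
  - intros; apply Df.
  - intros x _; apply derivable_continuous_pt.
    exists (f' x); apply is_derive_Reals, Df.
  - destruct (Req_dec s t) as [-> | Hst]; [lra |].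
    destruct (Req_dec c t) as [-> | Hct]; [rewrite H0 in E; lra |].
    assert (Hce : Rabs (c - t) < eps).
    { eapply Rle_lt_trans; [| exact Hs].
      unfold Rmin, Rmax in Hc; destruct (Rle_dec t s);
        [rewrite !Rabs_pos_eq | rewrite !Rabs_left1]; lra. }
    assert (Hs' := sgn c Hct Hce).
    unfold Rmin, Rmax in Hc; destruct (Rle_dec t s); nra.
Qed.

Lemma gain_local_max_iff (B k E t : R) :
  0 < E -> k ^ 2 < B * E -> admissible t ->
  within admissible (locally t) (fun s => gain B k E s <= gain B k E t)
  <-> crit B k E t = 0.
Proof.
  intros HE H Ht; assert (HN := quad_pos B k E t HE H); split.
  - intros [eps He].
    (* Within this radius all points are admissible, so the maximum is an unrestricted local one and
       Fermat's theorem applies. *)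
    set (r := Rmin eps (Rmin (Rabs t) (Rabs (t - 1)))).
    destruct Ht as [Ht0 Ht1].
    assert (Hr : 0 < r).
    { repeat apply Rmin_glb_lt; [apply cond_pos | apply Rabs_pos_lt | apply Rabs_pos_lt]; lra. }
    assert (D := gain_derive B k E t HE H).
    assert (pr : derivable_pt (gain B k E) t).
    { apply ex_derive_Reals_0; eexists; exact D. }
    assert (Z : derive_pt (gain B k E) t pr = 0).
    { apply deriv_maximum with (t - r) (t + r); [lra | lra |].
      intros x H1 H2.
      assert (Hx : Rabs (x - t) < r) by (apply Rabs_def1; lra).
      apply He.
      - change (Rabs (x - t) < eps); eapply Rlt_le_trans; [exact Hx | apply Rmin_l].
      - assert (X1 : r <= Rabs t) by (eapply Rle_trans; [apply Rmin_r | apply Rmin_l]).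
        assert (X2 : r <= Rabs (t - 1)) by (eapply Rle_trans; [apply Rmin_r | apply Rmin_r]).
        split; intros ->.
        + rewrite Rminus_0_l, Rabs_Ropp in Hx; lra.
        + rewrite Rabs_minus_sym in Hx; lra. }
    rewrite Derive_Reals, (is_derive_unique _ _ _ D) in Z.
    apply (Rmult_eq_reg_l (2 * t * (1 - t) / quad B k E t ^ 4)).
    + rewrite Rmult_0_r, <- Z; field; lra.
    + apply Rmult_integral_contrapositive_currified.
      * repeat apply Rmult_integral_contrapositive_currified; lra.
      * apply Rinv_neq_0_compat, pow_nonzero; lra.
  - intros H0.
    assert (L : locally t (fun s => gain B k E s <= gain B k E t)).
    { eapply second_derivative_test.
      - intros s; now apply gain_derive.
      - now apply gain_derive2_at_root.
      - cbv beta; rewrite H0; unfold Rdiv; ring.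
      - assert (R := root_simple B k E t HE H Ht H0).
        unfold Rdiv; apply Ropp_lt_cancel; rewrite Ropp_0, Ropp_mult_distr_l.
        apply Rmult_lt_0_compat; [lra | apply Rinv_0_lt_compat, pow_lt, HN]. }
    unfold within; revert L; apply filter_imp; auto.
Qed.

Lemma cubic_positive (c3 c2 c1 c0 : R) :
  0 < c3 -> exists t, 1 < t /\ 0 < c3 * t ^ 3 + c2 * t ^ 2 + c1 * t + c0.
Proof.
  intros H.
  set (S := Rabs c2 + Rabs c1 + Rabs c0).
  assert (P2 := Rabs_pos c2); assert (P1 := Rabs_pos c1); assert (P0 := Rabs_pos c0).
  assert (HS : 0 <= S / c3).
  { apply Rmult_le_pos; [unfold S; lra | left; now apply Rinv_0_lt_compat]. }
  (* Then [c3 * t = S + 2 * c3], and as [t >= 1] the leading term exceeds [S * t ^ 2], which bounds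
     the lower terms. *)
  exists (S / c3 + 2); split; [lra |].
  set (t := S / c3 + 2).
  assert (Ht : 2 <= t) by (unfold t; lra).
  assert (E : c3 * t = S + 2 * c3) by (unfold t; field; lra).
  assert (B2 := Rle_abs (- c2)); assert (B1 := Rle_abs (- c1)); assert (B0 := Rle_abs (- c0)).
  rewrite Rabs_Ropp in B2, B1, B0.
  assert (T2 : t <= t ^ 2) by nra.
  assert (X2 : - (Rabs c2 * t ^ 2) <= c2 * t ^ 2) by nra.
  assert (X1 : - (Rabs c1 * t ^ 2) <= c1 * t) by nra.
  assert (X0 : - (Rabs c0 * t ^ 2) <= c0) by nra.
  replace (c3 * t ^ 3) with (c3 * t * t ^ 2) by ring; rewrite E; unfold S; nra.
Qed.

Lemma crit_continuity (B k E : R) : continuity (crit B k E).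
Proof. unfold crit, quad; intros x; reg. Qed.

Lemma crit_root_between (B k E x y : R) :
  x < y -> crit B k E x * crit B k E y < 0 ->
  exists t, x < t < y /\ crit B k E t = 0.
Proof.
  intros Hxy H.
  destruct (IVT_cor (crit B k E) x y (crit_continuity B k E)) as (t & Ht & H0); [lra | lra |].
  exists t; split; [| exact H0].
  split; apply Rnot_le_lt; intros Hle.
  - replace t with x in H0 by lra; rewrite H0 in H; lra.
  - replace t with y in H0 by lra; rewrite H0 in H; lra.
Qed.

(** The cubic has leading coefficient [E > 0], is positive at [0] and negative at [1], which gives
    three sign changes and hence all its roots. *)
Lemma crit_roots (B k E : R) :
  0 < E -> k ^ 2 < B * E ->
  exists r s t, 1 < r /\ s < 0 /\ 0 < t < 1 /\
    crit B k E r = 0 /\ crit B k E s = 0 /\ crit B k E t = 0 /\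
    forall x, crit B k E x = 0 -> x = r \/ x = s \/ x = t.
Proof.
  intros HE H.
  assert (F : forall x, crit B k E x =
    E * x ^ 3 + - (k + 2 * E) * x ^ 2 + - (k + 2 * B) * x + B)
    by (intros x; unfold crit, quad; ring).
  assert (C0 : 0 < crit B k E 0).
  { assert (Q := quad_pos B k E 0 HE H); unfold crit; lra. }
  assert (C1 : crit B k E 1 < 0).
  { assert (Q := quad_pos B k E 1 HE H); unfold crit; lra. }
  destruct (cubic_positive E (- (k + 2 * E)) (- (k + 2 * B)) B HE) as (X & HX & CX).
  rewrite <- F in CX.
  (* These are the coefficients of [- crit B k E (- y)] as a polynomial in [y]. *)
  destruct (cubic_positive E (k + 2 * E) (- (k + 2 * B)) (- B) HE) as (Y & HY & CY).
  assert (CY' : crit B k E (- Y) < 0) by (rewrite F; nra).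
  destruct (crit_root_between B k E 1 X) as (r & Hr & Zr); [lra | nra |].
  destruct (crit_root_between B k E (- Y) 0) as (s & Hs & Zs); [lra | nra |].
  destruct (crit_root_between B k E 0 1) as (t & Ht & Zt); [lra | nra |].
  exists r, s, t; repeat split; try tauto; try lra.
  intros x Zx.
  rewrite F in Zr, Zs, Zt, Zx.
  (* Newton's divided differences *)
  assert (G : E * (x - r) * (x - s) * (x - t) = 0).
  { assert (D1 : E * (r ^ 2 + r * s + s ^ 2) - (k + 2 * E) * (r + s) - (k + 2 * B) = 0).
    { apply (Rmult_eq_reg_l (r - s)); lra. }
    assert (D2 : E * (t ^ 2 + t * s + s ^ 2) - (k + 2 * E) * (t + s) - (k + 2 * B) = 0).
    { apply (Rmult_eq_reg_l (t - s)); lra. }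
    assert (D3 : E * (r + s + t) - (k + 2 * E) = 0).
    { apply (Rmult_eq_reg_l (r - t)); lra. }
    assert (V3 : k = E * (r + s + t) - 2 * E) by lra.
    assert (V2 : 2 * B = E * (r ^ 2 + r * s + s ^ 2) - (k + 2 * E) * (r + s) - k) by lra.
    assert (V1 : B = - (E * r ^ 3 - (k + 2 * E) * r ^ 2 - (k + 2 * B) * r)) by lra.
    transitivity (E * x ^ 3 + - (k + 2 * E) * x ^ 2 + - (k + 2 * B) * x + B); [| exact Zx].
    rewrite V1 at 2; rewrite V2, V3; ring. }
  apply Rmult_integral in G; destruct G as [G | G]; [| lra].
  apply Rmult_integral in G; destruct G as [G | G]; [| lra].
  apply Rmult_integral in G; destruct G as [G | G]; lra.
Qed.

(** * Axis and parameter of an exparabola in terms of the cubic *)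

Lemma on_axis_iff (P : parabola) (u X : point) :
  focal_vector P u -> on_axis P X <-> det u (vec (focus P) X) = 0.
Proof.
  intros Hu; split.
  - intros (U & V & HS & HX); now apply (symmetry_line_axis P u U V X Hu HS).
  - intros HX.
    set (F := focus P) in *.
    set (V := (fst F + fst u, snd F + snd u)).
    assert (HS : symmetry_line P F V).
    { destruct Hu as (Hu & HE & _); split.
      - intros E; apply Hu; assert (E1 := f_equal fst E); assert (E2 := f_equal snd E).
        unfold V in E1, E2; destruct u; simpl in *; f_equal; lra.
      - intros Y; rewrite !on_parabola_eqn, !HE.
        fold F; unfold V; now rewrite reflect_axis. }
    exists F, V; split; [exact HS |].
    now apply (symmetry_line_axis P u F V X Hu HS).
Qed.

Lemma on_axis_same (P Q : parabola) (X : point) :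
  same_parabola P Q -> on_axis P X -> on_axis Q X.
Proof.
  intros H (U & V & [HUV HS] & HX); exists U, V; split; [split |]; auto.
  intros Y; now rewrite <- !(H _).
Qed.

Definition pt_sub (a b : point) : point := (fst a - fst b, snd a - snd b).

(** The arguments are the coefficients of [|d|^2] for [d = b + t (a - b)]. *)
Definition crit_at (a b : point) : R -> R :=
  crit (dot b b) (dot b (pt_sub a b)) (dot (pt_sub a b) (pt_sub a b)).
Definition gain_at (a b : point) : R -> R :=
  gain (dot b b) (dot b (pt_sub a b)) (dot (pt_sub a b) (pt_sub a b)).

Lemma gram_pos (a b : point) :
  det a b <> 0 ->
  0 < dot (pt_sub a b) (pt_sub a b) /\
  dot b (pt_sub a b) ^ 2 < dot b b * dot (pt_sub a b) (pt_sub a b).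
Proof.
  intros H; split.
  - apply dot_pos; intros E; apply H; injection E as E1 E2.
    unfold det; replace (fst a) with (fst b) by lra; replace (snd a) with (snd b) by lra; ring.
  - assert (L : dot b b * dot (pt_sub a b) (pt_sub a b)
      = dot b (pt_sub a b) ^ 2 + det a b ^ 2) by (unfold dot, det, pt_sub; simpl; ring).
    assert (P := pow2_gt_0 _ H); lra.
Qed.

Lemma dot_axis_dir (a b : point) (t : R) :
  dot (axis_dir a b t) (axis_dir a b t) =
    quad (dot b b) (dot b (pt_sub a b)) (dot (pt_sub a b) (pt_sub a b)) t.
Proof. unfold quad, dot, pt_sub; simpl; ring. Qed.

Lemma dot_axis_vec (a b : point) (t : R) :
  det a b <> 0 ->
  dot (axis_vec a b t) (axis_vec a b t) = (2 * det a b ^ 2) ^ 2 * gain_at a b t.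
Proof.
  intros H; assert (HN := axis_dir_pos a b t H).
  unfold axis_vec, gain_at, gain; rewrite <- dot_axis_dir.
  set (d := axis_dir a b t) in *; set (N := dot d d) in *.
  transitivity ((2 * t * (1 - t) * det a b ^ 2 / N ^ 2) ^ 2 * dot d d).
  - clearbody N; unfold dot, scale; cbn [fst snd]; ring.
  - fold N; field; lra.
Qed.

(** At admissible indices the parameter is the square root of a positive constant times [gain_at],
    whatever records [p] selects, so both functions have the same local maxima. *)
Lemma parameter_local_max_iff (A B C : point) (p : R -> parabola) (t : R) :
  ~ collinear A B C -> exparabola_family A B C p -> admissible t ->
  local_max_on admissible (fun s => parameter (p s)) t <->
  crit_at (vec C A) (vec C B) t = 0.
Proof.
  intros H Hp Ht.
  destruct (sides_nondegenerate A B C H) as (HD & _).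
  set (a := vec C A) in *; set (b := vec C B) in *.
  destruct (gram_pos a b HD) as [HE HG].
  unfold crit_at; rewrite <- gain_local_max_iff by assumption.
  fold (gain_at a b).
  assert (K : 0 < (2 * det a b ^ 2) ^ 2).
  { apply pow_lt, Rmult_lt_0_compat; [lra | now apply pow2_gt_0]. }
  assert (Q : forall s, admissible s ->
    parameter (p s) = sqrt ((2 * det a b ^ 2) ^ 2 * gain_at a b s)).
  { intros s Hs; destruct (proj1 (exparabola_at_iff_data A B C s (p s) H Hs) (Hp s Hs))
      as [(_ & _ & E) _].
    rewrite E; f_equal; now apply dot_axis_vec. }
  assert (M : forall s, admissible s ->
    parameter (p s) <= parameter (p t) <-> gain_at a b s <= gain_at a b t).
  { intros s Hs; rewrite !Q by assumption; split; intros L.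
    - apply (Rmult_le_reg_l _ _ _ K); apply sqrt_le_0; [| | exact L];
        rewrite <- dot_axis_vec by assumption; unfold dot; nra.
    - apply sqrt_le_1_alt; now apply Rmult_le_compat_l; [left |]. }
  unfold local_max_on, within; split.
  - intros [_ L]; revert L; apply filter_imp; intros s L Hs; now apply M, L.
  - intros L; split; [exact Ht |]; revert L; apply filter_imp; intros s L Hs; now apply M, L.
Qed.

(** The link between the two statements of the theorem: [det d ((a + b) / 3) = (2 t - 1) / 3 * det a
    b], while [det d f] comes from the two determinants of the focus; over the denominator [|d|^2]
    their difference is a multiple of the same cubic. *)
Lemma centroid_crit (A B C : point) (t : R) :
  let a := vec C A in let b := vec C B in
  det a b <> 0 ->
  det (axis_dir a b t)
    (fst (vec C (centroid A B C)) - fst (focus_offset a b t),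
     snd (vec C (centroid A B C)) - snd (focus_offset a b t)) =
  2 / 3 * det a b * crit_at a b t / dot (axis_dir a b t) (axis_dir a b t).
Proof.
  intros a b H; assert (HN := axis_dir_pos a b t H).
  assert (E1 := det_focus_offset_l a b t H).
  assert (E2 := det_focus_offset_r a b t H).
  set (f := focus_offset a b t) in *.
  assert (G1 : fst (vec C (centroid A B C)) = (fst a + fst b) / 3)
    by (unfold a, b, vec, centroid, bary; simpl; field).
  assert (G2 : snd (vec C (centroid A B C)) = (snd a + snd b) / 3)
    by (unfold a, b, vec, centroid, bary; simpl; field).
  rewrite G1, G2; clear G1 G2; clearbody a b f.
  transitivity ((2 * t - 1) / 3 * det a b - (t * det a f + (1 - t) * det b f)).
  { unfold det; simpl; field. }
  rewrite E1, E2; unfold crit_at, crit; rewrite <- dot_axis_dir.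
  apply (Rmult_eq_reg_r (dot (axis_dir a b t) (axis_dir a b t))); [| lra].
  set (N := dot (axis_dir a b t) (axis_dir a b t)) in *.
  field_simplify; [| lra | lra].
  unfold N, dot, pt_sub; simpl; field.
Qed.

Lemma on_axis_centroid_iff (A B C : point) (t : R) (P : parabola) :
  ~ collinear A B C -> admissible t -> exparabola_data A B C t P ->
  on_axis P (centroid A B C) <-> crit_at (vec C A) (vec C B) t = 0.
Proof.
  intros H [Ht0 Ht1] [Hu Hf].
  destruct (sides_nondegenerate A B C H) as (HD & _).
  rewrite (on_axis_iff P _ _ Hu).
  assert (E := centroid_crit A B C t HD); cbv zeta in E.
  rewrite <- Hf in E.
  assert (HN := axis_dir_pos _ _ t HD).
  set (a := vec C A) in *; set (b := vec C B) in *; set (G := centroid A B C) in *.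
  set (r := 2 * t * (1 - t) * det a b ^ 2 / dot (axis_dir a b t) (axis_dir a b t) ^ 2).
  set (N := dot (axis_dir a b t) (axis_dir a b t)) in *.
  assert (Hr : r <> 0).
  { unfold r, Rdiv; apply Rmult_integral_contrapositive_currified.
    - repeat apply Rmult_integral_contrapositive_currified; lra.
    - apply Rinv_neq_0_compat, pow_nonzero; lra. }
  assert (E' : det (axis_vec a b t) (vec (focus P) G) =
    r * (2 / 3 * det a b / N) * crit_at a b t).
  { transitivity (r * (2 / 3 * det a b * crit_at a b t / N)); [| unfold Rdiv; ring].
    rewrite <- E; unfold axis_vec; fold N r; unfold det, scale, vec; cbn [fst snd]; ring. }
  rewrite E'; split; intros Z; [| rewrite Z; ring].
  apply Rmult_integral in Z; destruct Z as [Z | Z]; [exfalso; revert Z | exact Z].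
  apply Rmult_integral_contrapositive_currified; [exact Hr |].
  apply Rmult_integral_contrapositive_currified; [| apply Rinv_neq_0_compat; lra].
  apply Rmult_integral_contrapositive_currified; [lra | exact HD].
Qed.

(** * Families of exparabolas and the three max-exparabolas *)

(** [max_exparabola] asks for a whole family; choice supplies one that has the given record at [t],
    with [P] as default at inadmissible indices. *)
Lemma family_through (A B C : point) (t : R) (P : parabola) :
  ~ collinear A B C -> exparabola_at A B C t P ->
  exists p, exparabola_family A B C p /\ p t = P.
Proof.
  intros H HP.
  assert (X : forall s, exists Q, (admissible s -> exparabola_at A B C s Q) /\ (s = t -> Q = P)).
  { intros s; destruct (Req_dec s t) as [-> | Hst]; [now exists P |].
    destruct (classic (admissible s)) as [Hs | Hs].
    - destruct (data_exists A B C s H Hs) as [Q HQ].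
      exists Q; split; [intros _; now apply exparabola_at_iff_data | tauto].
    - exists P; tauto. }
  exists (fun s => proj1_sig (constructive_indefinite_description _ (X s))); split.
  - intros s Hs; now apply (proj2_sig (constructive_indefinite_description _ (X s))).
  - now apply (proj2_sig (constructive_indefinite_description _ (X t))).
Qed.

Lemma exparabola_at_exparabola (A B C : point) (t : R) (P : parabola) :
  exparabola_at A B C t P -> exparabola A B C P.
Proof. intros (HA & HB & HC); repeat split; eexists; eassumption. Qed.

Lemma max_exparabola_iff (A B C : point) (t : R) (P : parabola) :
  ~ collinear A B C -> admissible t -> exparabola_data A B C t P ->
  max_exparabola A B C P <-> crit_at (vec C A) (vec C B) t = 0.
Proof.
  intros H Ht HP; split.
  (* The index [s] comes with the family and is not compared with [t]. The root property passes from
     [s] to [t] through the axis condition, which depends only on the curve. *)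
  - intros (_ & p & s & Hp & HL & HS).
    assert (Hs := proj1 HL).
    apply (parameter_local_max_iff A B C p s H Hp Hs) in HL.
    assert (Hps := proj1 (exparabola_at_iff_data A B C s (p s) H Hs) (Hp s Hs)).
    apply (on_axis_centroid_iff A B C s _ H Hs Hps) in HL.
    apply (on_axis_centroid_iff A B C t P H Ht HP).
    apply (on_axis_same (p s)); [| exact HL].
    intros X; now rewrite (HS X).
  - intros Z.
    assert (HT : exparabola_at A B C t P) by now apply exparabola_at_iff_data.
    destruct (family_through A B C t P H HT) as (p & Hp & E).
    split; [now apply exparabola_at_exparabola with t |].
    exists p, t; split; [exact Hp | split].
    + now apply (parameter_local_max_iff A B C p t H Hp Ht).
    + rewrite E; intros X; tauto.
Qed.

(** The axes are not parallel: the determinant of the axis directions for [s] and [t] is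
    [(s - t) * det a b]. *)
Lemma axes_meet_once (A B C : point) (s t : R) (P Q : parabola) (X Y : point) :
  ~ collinear A B C -> admissible s -> admissible t -> s <> t ->
  exparabola_data A B C s P -> exparabola_data A B C t Q ->
  on_axis P X -> on_axis Q X -> on_axis P Y -> on_axis Q Y -> X = Y.
Proof.
  intros H Hs Ht Hst [Hu _] [Hv _].
  destruct (sides_nondegenerate A B C H) as (HD & _).
  rewrite !(on_axis_iff P _ _ Hu), !(on_axis_iff Q _ _ Hv).
  intros PX QX PY QY.
  destruct Hu as (Hu & _), Hv as (Hv & _).
  set (a := vec C A) in *; set (b := vec C B) in *.
  apply (det_inj (axis_vec a b s) (axis_vec a b t)).
  - unfold axis_vec in *.
    set (k := 2 * s * _ * _ / _) in *; set (l := 2 * t * _ * _ / _) in *.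
    assert (Hk : k <> 0).
    { intros E; apply Hu; rewrite E; unfold scale; f_equal; ring. }
    assert (Hl : l <> 0).
    { intros E; apply Hv; rewrite E; unfold scale; f_equal; ring. }
    replace (det _ _) with (k * l * (s - t) * det a b)
      by (unfold det, scale; simpl; ring).
    clearbody k l.
    repeat apply Rmult_integral_contrapositive_currified; try assumption; lra.
  - unfold det, vec in *; simpl fst in *; simpl snd in *; lra.
  - unfold det, vec in *; simpl fst in *; simpl snd in *; lra.
Qed.

Theorem corollary1 :
  forall A B C : point,
  ~ collinear A B C ->
  (forall P : parabola, exparabola A B C P ->
     (max_exparabola A B C P <-> on_axis P (centroid A B C)))
  /\
  (exists PA PB PC : parabola,
     (max_exparabola A B C PA /\ touches_inside PA B C) /\
     (max_exparabola A B C PB /\ touches_inside PB C A) /\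
     (max_exparabola A B C PC /\ touches_inside PC A B) /\
     (forall P : parabola, max_exparabola A B C P ->
        same_parabola P PA \/ same_parabola P PB \/ same_parabola P PC) /\
     (forall X : point,
        (on_axis PA X /\ on_axis PB X /\ on_axis PC X) <->
        X = centroid A B C)).
Proof.
  intros A B C H; split.
  - intros P HP.
    destruct (exparabola_has_data A B C P H HP) as (t & Ht & Hd).
    now rewrite (max_exparabola_iff A B C t P H Ht Hd), (on_axis_centroid_iff A B C t P H Ht Hd).
  - destruct (sides_nondegenerate A B C H) as (HD & _).
    destruct (gram_pos _ _ HD) as [HE HG].
    (* The intervals of the roots decide which side is touched inside: [BC] for [r > 1], [CA] for
       [s < 0], [AB] for [0 < t < 1]. *)
    destruct (crit_roots _ _ _ HE HG) as (r & s & t & Hr & Hs & Ht & Zr & Zs & Zt & Z).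
    assert (Ar : admissible r) by (split; lra).
    assert (As : admissible s) by (split; lra).
    assert (At : admissible t) by (split; lra).
    destruct (data_exists A B C r H Ar) as [PA DA].
    destruct (data_exists A B C s H As) as [PB DB].
    destruct (data_exists A B C t H At) as [PC DC].
    exists PA, PB, PC.
    assert (TA := proj2 (exparabola_at_iff_data A B C r PA H Ar) DA).
    assert (TB := proj2 (exparabola_at_iff_data A B C s PB H As) DB).
    assert (TC := proj2 (exparabola_at_iff_data A B C t PC H At) DC).
    refine (conj (conj _ _) (conj (conj _ _) (conj (conj _ _) (conj _ (fun X => conj _ _))))).
    + now apply (max_exparabola_iff A B C r).
    + exists (bary A B C 0 1 (r - 1)); split; [| apply TA].
      (* The normalized weight of [C] in [(0, 1, r - 1)]. *)
      exists ((r - 1) / r); split; [split |].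
      * apply Rdiv_lt_0_compat; lra.
      * apply Rlt_div_l; lra.
      * unfold bary, translate, vec; simpl; f_equal; field; lra.
    + now apply (max_exparabola_iff A B C s).
    + exists (bary A B C 1 0 (- s)); split; [| apply TB].
      (* The normalized weight of [A] in [(1, 0, - s)]. *)
      exists (1 / (1 - s)); split; [split |].
      * apply Rdiv_lt_0_compat; lra.
      * apply Rlt_div_l; lra.
      * unfold bary, translate, vec; simpl; f_equal; field; lra.
    + now apply (max_exparabola_iff A B C t).
    + exists (bary A B C (1 - t) t 0); split; [| apply TC].
      exists t; split; [exact Ht |].
      unfold bary, translate, vec; simpl; f_equal; field; lra.
    + intros P HP.
      destruct (exparabola_has_data A B C P H (proj1 HP)) as (x & Hx & Dx).
      apply (max_exparabola_iff A B C x P H Hx Dx) in HP.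
      assert (S : forall Q, exparabola_data A B C x Q -> same_parabola P Q).
      { intros Q HQ X; rewrite !on_parabola_eqn.
        now rewrite (same_data_same_eqn A B C x P Q Dx HQ). }
      destruct (Z x HP) as [-> | [-> | ->]]; auto.
    + intros (XA & XB & _).
      apply (axes_meet_once A B C r s PA PB X _ H Ar As); try assumption; [lra | |].
      * now apply (on_axis_centroid_iff A B C r).
      * now apply (on_axis_centroid_iff A B C s).
    + intros ->; repeat split.
      * now apply (on_axis_centroid_iff A B C r).
      * now apply (on_axis_centroid_iff A B C s).
      * now apply (on_axis_centroid_iff A B C t).
Qed.
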